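(* Let $\{X_\alpha,f_{\alpha\beta},D\}$ be an inverse limit system for which each factor space $X_\alpha$ is a Hausdorff continuum, each bonding function $f_{\alpha\beta}:X_\beta\to 2^{X_\alpha}$ is upper semi-continuous, and $D$ is a totally ordered set. Suppose that, for each finite subset $\{\beta_1,\beta_2,\ldots,\beta_n\}$ of $D$, $G(\beta_1,\beta_2,\ldots,\beta_n)$ is connected. Then $\varprojlim\mathbf{f}$ is a Hausdorff continuum.
   Context: A Hausdorff continuum is a non-empty, compact and connected subset of a Hausdorff space. For a non-empty compact Hausdorff space $X$, $2^X$ denotes the set of non-empty compact subsets of $X$. For non-empty compact Hausdorff spaces $X,Y$, a function $f:X\to 2^Y$ is upper semi-continuous (u.s.c.) if for all $x\in X$ and every open $V\subseteq Y$ containing $f(x)$ there is an open $U\subseteq X$ containing $x$ with $f(u)\subseteq V$ for each $u\in U$ (equivalently, its graph $\{(x,y)\in X\times Y \mid y\in f(x)\}$ is closed). For u.s.c. $f:X\to 2^Y$ and $g:Y\to 2^Z$, $(g\circ f)(x)=\{z\in Z\mid \exists y\in Y \text{ with } y\in f(x) \text{ and } z\in g(y)\}$. A totally ordered index set is a set $D$ with a reflexive, transitive, antisymmetric and total relation $\preceq$. An inverse limit system $\{X_\alpha,f_{\alpha\beta},D\}$ consists of compact Hausdorff spaces $X_\alpha$ and u.s.c. functions $f_{\alpha\beta}:X_\beta\to 2^{X_\alpha}$ for $\alpha\preceq\beta$ in $D$, where $f_{\alpha\alpha}$ is the identity on $X_\alpha$ (i.e. $f_{\alpha\alpha}(x)=\{x\}$),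 such that the collection $\mathbf{f}=\{f_{\alpha\beta}\mid\alpha\preceq\beta\in D\}$ is exact: $f_{\alpha\beta}\circ f_{\beta\eta}=f_{\alpha\eta}$ for all $\alpha\preceq\beta\preceq\eta$ in $D$. The inverse limit is $\varprojlim\mathbf{f}=\{\mathbf{x}\in\prod_{\alpha\in D}X_\alpha\mid x_\alpha\in f_{\alpha\beta}(x_\beta)\ \forall\,\alpha\preceq\beta\in D\}$, with the subspace topology from the product topology. Whenever a finite subset $\{\beta_1,\ldots,\beta_n\}$ of $D$ is written, it is understood that $\beta_i\preceq\beta_j$ iff $i\le j$. For such a subset, $G(\beta_1,\ldots,\beta_n)=\{(x_{\beta_1},\ldots,x_{\beta_n})\in\prod_{1\le i\le n}X_{\beta_i}\mid x_{\beta_i}\in f_{\beta_i\beta_j}(x_{\beta_j})\text{ for }1\le i\le j\le n\}$. *)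

(* Defs.v *)
From HB Require Import structures.
From mathcomp Require Import all_boot all_order.
From mathcomp Require Import boolp classical_sets topology.

Set Implicit Arguments.
Unset Strict Implicit.
Unset Printing Implicit Defensive.

Local Open Scope classical_set_scope.

(* A subset [A] of the space [T]; a space [X] that is itself a continuum is
   the case [A = [set: X]]. *)
Definition hausdorff_continuum (T : topologicalType) (A : set T) : Prop :=
  [/\ hausdorff_space T, A !=set0, compact A & connected A].

(* The set 2^Y. A function X -> 2^Y is represented by [f : X -> set Y] whose
   values all lie in [hyperspace Y]. *)
Definition hyperspace (Y : topologicalType) : set (set Y) :=
  [set A | A !=set0 /\ compact A].

Definition usc (X Y : topologicalType) (f : X -> set Y) : Prop :=
  forall (x : X) (V : set Y), open V -> f x `<=` V ->
  exists U : set X, [/\ open U, U x & forall u, U u -> f u `<=` V].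

Definition set_valued_comp (X Y Z : Type) (g : Y -> set Z) (f : X -> set Y) :
    X -> set Z :=
  fun x => [set z | exists y, f x y /\ g y z].

(* [f a b] is the bonding function from [X b] to [2^(X a)]; it is meaningful
   only for [a <= b], and its values at other pairs of indices are never
   used. *)
Section InverseLimit.
Context {d : Order.disp_t} {D : orderType d} {X : D -> topologicalType}.
Variable f : forall a b : D, X b -> set (X a).
Arguments f : clear implicits.

Record inverse_limit_system : Prop := InverseLimitSystem {
  ils_nonempty : forall a, [set: X a] !=set0;
  ils_compact : forall a, compact [set: X a];
  ils_hausdorff : forall a, hausdorff_space (X a);
  ils_hyperspace : forall a b, (a <= b)%O -> forall x, hyperspace (f a b x);
  ils_usc : forall a b, (a <= b)%O -> usc (f a b);
  ils_id : forall a x, f a a x = [set x];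
  ils_exact : forall a b c, (a <= b)%O -> (b <= c)%O ->
    set_valued_comp (f a b) (f b c) = f a c }.

Definition inverse_limit : set (prod_topology X) :=
  [set x | forall a b, (a <= b)%O -> f a b (x b) (x a)].

Definition G (n : nat) (beta : 'I_n -> D) :
    set (prod_topology (fun i : 'I_n => X (beta i))) :=
  [set x | forall i j : 'I_n, (i <= j)%N -> f (beta i) (beta j) (x j) (x i)].

End InverseLimit.

Arguments G {d D X} f {n} beta.

(* Main.v *)
Require Import Defs.
From HB Require Import structures.
From mathcomp Require Import all_boot all_order.
From mathcomp Require Import boolp classical_sets topology.

Set Implicit Arguments.
Unset Strict Implicit.

Import Order.TTheory.
Local Open Scope classical_set_scope.

(** For a finite list [s] of indices, let [L s] be the set of points of the
    product that satisfy the bonding relations between the indices in [s].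
    These sets are closed, directed and nonempty, and they intersect in the
    inverse limit, so an open set containing the inverse limit contains some
    [L s]; with the empty open set this says that the inverse limit is
    nonempty. If the inverse limit split into two closed pieces, separate them
    by disjoint open sets [U] and [V] and choose [s] with [L s] in [U `|` V].
    Take points [x] in [U] and [y] in [V] of the inverse limit. Padding the
    finite-coordinate graph [G s] with the coordinates of a fixed point maps it
    continuously into [L s]; once [s] is large enough, the padded restrictions
    of [x] and [y] still lie in [U] and [V], so [G s] is disconnected. *)

(** * Separation in compact Hausdorff spaces *)

Lemma open_disjoint_separated (T : topologicalType) (U V : set T) :
  open U -> open V -> U `&` V = set0 -> separated U V.
Proof.
move=> oU oV UV0; split; rewrite -subset0 => z.
  move=> [clUz Vz]; rewrite -UV0.
  by have := clUz V (open_nbhs_nbhs (conj oV Vz)); rewrite UV0 => -[].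
move=> [Uz clVz]; rewrite -UV0.
by have := clVz U (open_nbhs_nbhs (conj oU Uz)); rewrite setIC UV0 => -[].
Qed.

Lemma separated_closedl (T : topologicalType) (A B : set T) :
  closed (A `|` B) -> separated A B -> closed A.
Proof.
move=> clAB [AB0 _] z clAz.
have [//|Bz] : (A `|` B) z by apply: clAB; apply: closureS clAz; left.
by have : (closure A `&` B) z by []; rewrite AB0.
Qed.

(** Separated pieces of a closed set are themselves closed, so normality applies: [A] has a
    neighbourhood [C] whose closure misses [B], and the complement of that closure serves as [V]. *)
Lemma separated_closed_open_separation (T : topologicalType) (A B : set T) :
  hausdorff_space T -> compact [set: T] -> closed (A `|` B) -> separated A B ->
  exists U V, [/\ open U, open V, U `&` V = set0, A `<=` U & B `<=` V].
Proof.
move=> hT cT clAB sAB.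
have clA : closed A by exact: separated_closedl clAB sAB.
have clB : closed B.
  by apply: (@separated_closedl _ _ A); rewrite 1?setUC // separatedC.
have AB0 := separated_disjoint sAB.
have : set_nbhs A (~` B).
  apply/set_nbhsP; exists (~` B); split => //; first exact: closed_openC.
  exact/disjoints_subset.
move=> /(compact_normal hT cT clA) [C CA CB].
have /set_nbhsP[U [oU AU UC]] := CA.
exists U, (~` closure C); split => //.
- exact/closed_openC/closed_closure.
- apply/disjoints_subset; rewrite setCK.
  exact: subset_trans UC (@subset_closure _ _).
- by move=> z Bz /CB.
Qed.

(** * Neighbourhoods, maps and compactness in products *)

Lemma prod_nbhs_finite (I : choiceType) (X : I -> topologicalType)
    (x : prod_topology X) (U : set (prod_topology X)) :
  nbhs x U -> exists s : seq I,
    forall y : prod_topology X, (forall i, i \in s -> y i = x i) -> U y.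
Proof.
(* It suffices that this filter converges to [x]. The product topology is a supremum, so convergence
   is checked one coordinate at a time, where a one-element list is enough. *)
pose F : set_system (prod_topology X) := fun A => exists s : seq I,
  forall y : prod_topology X, (forall i, i \in s -> y i = x i) -> A y.
have FF : Filter F.
  split; first by exists [::].
  - move=> A B [s sA] [t tB]; exists (s ++ t) => y ysx; split.
      by apply: sA => i si; apply: ysx; rewrite mem_cat si.
    by apply: tB => i ti; apply: ysx; rewrite mem_cat ti orbT.
  - by move=> A B AB [s sA]; exists s => y /sA /AB.
suff : F --> x by move=> /(_ U).
apply/cvg_sup => i A [_ [[B oB <-] /= Bx]] /filterS; apply.
by exists [:: i] => y /(_ i (mem_head _ _)) /= ->.
Qed.

Lemma prod_continuous (T : topologicalType) (I : Type)
    (X : I -> topologicalType) (h : T -> prod_topology X) :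
  (forall i, continuous (fun t => h t i)) -> continuous h.
Proof.
move=> hc t; apply/cvg_sup => i A [_ [[B oB <-] /= Bx]] /filterS; apply.
by apply: (hc i t); exact: open_nbhs_nbhs.
Qed.

Lemma prod_compact (I : eqType) (X : I -> topologicalType) :
  (forall i, compact [set: X i]) -> compact [set: prod_topology X].
Proof.
move=> cX.
have -> : [set: prod_topology X] = [set x | forall i, [set: X i] (x i)].
  by apply/seteqP; split.
exact: (tychonoff (A := fun i => [set: X i])).
Qed.

(** * Extending a family of coordinates to the whole product *)

Section Pad.
Context {I J : eqType} {X : I -> topologicalType}.
Variables (beta : J -> I) (p : prod_topology X).
Hypothesis beta_inj : injective beta.

(** A preimage of [i] under [beta] is chosen classically; the cast moves the value from [X (beta j)]
    to [X i]. *)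
Definition pad (y : prod_topology (fun j => X (beta j))) : prod_topology X :=
  fun i => if pselect (exists j, beta j = i) is left h
           then ecast i (X i) (proj2_sig (cid h)) (y (proj1_sig (cid h)))
           else p i.

Lemma padE y j : pad y (beta j) = y j.
Proof.
rewrite /pad; case: pselect => [h|[]]; last by exists j.
(* The chosen preimage [k] equals [j] by injectivity. What remains is a cast along a proof of
   [beta j = beta j], which is trivial because equality on [I] is decidable. *)
case: (cid h) => k /= /[dup] /beta_inj kj; case: _ / kj => e.
by rewrite eq_axiomK.
Qed.

Lemma pad_continuous : continuous pad.
Proof.
apply: prod_continuous => i; rewrite /pad.
case: pselect => [h|_]; last exact: cst_continuous.
case: (cid h) => k /= e; case: _ / e => /=.
exact: proj_continuous.
Qed.

End Pad.
Arguments pad {I J X} beta p y.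

(** * Partial limits and compactness *)

Section Thread.
Context {d : Order.disp_t} {D : orderType d} {X : D -> topologicalType}.
Variable f : forall a b : D, X b -> set (X a).
Arguments f : clear implicits.
Hypothesis f_system : inverse_limit_system f.

Definition partial_limit (s : seq D) : set (prod_topology X) :=
  [set x | forall a b, a \in s -> b \in s -> (a <= b)%O -> f a b (x b) (x a)].

Lemma partial_limitS s t : {subset s <= t} ->
  partial_limit t `<=` partial_limit s.
Proof. by move=> st x xt a b /st ta /st tb; exact: xt. Qed.

(** Off the graph, regularity gives a neighbourhood [C] of [x a] whose closure misses the closed set
    [f a b (x b)]. Upper semi-continuity keeps the values near [x b] away from that closure, so a
    neighbourhood of [x] misses the graph. *)
Lemma bonding_graph_closed a b : (a <= b)%O ->
  closed [set x : prod_topology X | f a b (x b) (x a)].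
Proof.
move=> ab x clx; apply: contrapT => fx.
have [_ fxc] := ils_hyperspace f_system ab (x b).
have clf := compact_closed (@ils_hausdorff _ _ _ _ f_system a) fxc.
have [C Cxa CF] : exists2 C, nbhs (x a) C & closure C `<=` ~` f a b (x b).
  have Xa := @ils_hausdorff _ _ _ _ f_system a.
  apply: (compact_regular Xa (@ils_compact _ _ _ _ f_system a)).
    exact: filterT.
  by apply: open_nbhs_nbhs; split => //; exact: closed_openC.
have oC : open (~` closure C) by exact/closed_openC/closed_closure.
have [|U [oU Uxb UC]] := ils_usc f_system ab (x := x b) oC.
  by move=> z fz /CF.
have /clx [z [/= fz [Uz Cz]]] :
    nbhs x ((fun z : prod_topology X => z b) @^-1` U `&`
            (fun z : prod_topology X => z a) @^-1` C).
  apply: filterI; apply: proj_continuous => //.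
  exact: open_nbhs_nbhs.
by apply: UC Uz _ fz _; exact: subset_closure.
Qed.

Lemma partial_limit_closed s : closed (partial_limit s).
Proof.
move=> x clx a b sa sb ab; apply: (bonding_graph_closed ab).
by apply: closureS clx => z; exact.
Qed.

Lemma inverse_limit_closed : closed (inverse_limit f).
Proof.
move=> x clx a b ab; apply: (bonding_graph_closed ab).
by apply: closureS clx => z; exact.
Qed.

Lemma prod_nonempty : [set: prod_topology X] !=set0.
Proof. by exists (fun a => projT1 (cid (ils_nonempty f_system a))). Qed.

(** Coordinates are chosen from the largest index downwards. Only the value at the next index [b]
    guides the choice at [a]; exactness yields the relations with all later indices. *)
Lemma sorted_partial_limit_nonempty s :
  sorted <=%O s -> partial_limit s !=set0.
Proof.
elim: s => [|a [|b s] IH] /=.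
- by case: prod_nonempty => x _; exists x.
- move=> _; case: prod_nonempty => x _; exists x => ? ?.
  by rewrite !inE => /eqP-> /eqP-> _; rewrite (ils_id f_system).
move=> /andP[ab bs]; have [x xs] := IH bs.
have [[y fy] _] := ils_hyperspace f_system ab (x b).
have b_le c : c \in b :: s -> (b <= c)%O.
  rewrite inE => /orP[/eqP->//|]; exact: (allP (le_path_min bs)).
have fac c : c \in b :: s -> f a c (x c) y.
  move=> sc; rewrite -(ils_exact f_system ab (b_le c sc)).
  by exists (x b); split => //; apply: xs => //; [exact: mem_head|exact: b_le].
exists (dfwith x y) => u v us vs uv.
case: (dfwithP x y v) vs uv => [_|v' av]; last first.
  rewrite inE eq_sym (negPf av) /= => vs uv.
  case: (dfwithP x y u) us uv => [_ _|u' au]; first exact: fac.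
  by rewrite inE eq_sym (negPf au) /= => us; exact: xs.
case: (dfwithP x y u) us => [_ _|u' au]; first by rewrite (ils_id f_system).
rewrite inE eq_sym (negPf au) /= => /b_le bu ua.
(* The larger index is now [a] and the smaller one lies in the sorted tail, so the two would
   coincide. *)
have : (a <= u')%O by exact: le_trans bu.
by move=> au'; case/negP: au; rewrite eq_le au' ua.
Qed.

Lemma partial_limit_nonempty s : partial_limit s !=set0.
Proof.
have [x xs] := @sorted_partial_limit_nonempty (sort <=%O s)
  (sort_le_sorted s).
by exists x; apply: partial_limitS xs => a; rewrite mem_sort.
Qed.

Lemma prod_system_compact : compact [set: prod_topology X].
Proof. exact/prod_compact/(ils_compact f_system). Qed.

Lemma prod_system_hausdorff : hausdorff_space (prod_topology X).
Proof. exact/hausdorff_product/(ils_hausdorff f_system). Qed.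

(** Otherwise the closed sets [partial_limit s] minus [W] are nonempty and directed, so by
    compactness they share a point. It lies outside [W]. *)
Lemma partial_limit_sub_open (W : set (prod_topology X)) :
  open W -> inverse_limit f `<=` W -> exists s, partial_limit s `<=` W.
Proof.
move=> oW fW; apply: contrapT => noS.
pose F : set_system (prod_topology X) :=
  fun A => exists s, partial_limit s `\` W `<=` A.
have PF : ProperFilter F.
  split; last split.
  - move=> [s s0]; apply: noS; exists s => x sx.
    by apply: contrapT => Wx; exact: (s0 x).
  - by exists [::].
  - move=> A B [s sA] [t tB]; exists (s ++ t) => x [stx Wx]; split.
      apply: sA; split => //; apply: partial_limitS stx => a.
      by rewrite mem_cat => ->.
    apply: tB; split => //; apply: partial_limitS stx => a.
    by rewrite mem_cat orbC => ->.
  - by move=> A B AB [s sA]; exists s => x /sA /AB.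
have [x [_ Fx]] := prod_system_compact (F := F) PF filterT.
have xs s : (partial_limit s `\` W) x.
  have : closed (partial_limit s `\` W).
    apply: closedI; last exact: open_closedC.
    exact: partial_limit_closed.
  by apply => V; apply: Fx; exists s.
(* Each bonding relation involves two indices only, so two-element lists place [x] in the inverse
   limit. *)
have [_] := xs [::]; apply; apply: fW => a b ab.
by have [+ _] := xs [:: a; b]; apply => //; rewrite !inE eqxx ?orbT.
Qed.

Lemma inverse_limit_nonempty : inverse_limit f !=set0.
Proof.
apply/set0P/eqP => f0.
have [|s s0] := @partial_limit_sub_open set0 open0; first by rewrite f0.
by have [x /s0] := partial_limit_nonempty s.
Qed.

Lemma partial_limit_pad n (beta : 'I_n -> D) (p : prod_topology X) :
  (forall i j, (beta i <= beta j)%O = (i <= j)%N) ->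
  injective beta -> G f beta `<=` pad beta p @^-1` partial_limit (codom beta).
Proof.
move=> beta_le beta_inj x Gx _ _ /codomP[i ->] /codomP[j ->].
by rewrite beta_le !padE //; exact: Gx.
Qed.

End Thread.

(** * Connectedness through finite sets of indices *)

Lemma sorted_enumeration (d : Order.disp_t) (D : orderType d) (s : seq D) :
  exists n (beta : 'I_n -> D),
    [/\ forall i j, (beta i <= beta j)%O = (i <= j)%N, injective beta
      & forall a, a \in s -> exists i, beta i = a].
Proof.
(* Without duplicates the sort is strict, so positions reflect the order of [D], as the hypothesis
   on [G] demands. *)
pose t := sort <=%O (undup s).
have t_sorted : sorted <%O t by rewrite sort_lt_sorted undup_uniq.
have beta_le (i j : 'I_(size t)) :
    (tnth (in_tuple t) i <= tnth (in_tuple t) j)%O = (i <= j)%N.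
  have x0 := tnth (in_tuple t) i; rewrite !(tnth_nth x0).
  by apply: lt_sorted_leq_nth; rewrite ?inE.
exists (size t), (tnth (in_tuple t)); split => //.
  move=> i j e; apply/val_inj/eqP; rewrite eqn_leq -!beta_le e.
  by rewrite lexx.
move=> a sa; have /tnthP[i ->] : a \in in_tuple t by rewrite mem_sort mem_undup.
by exists i.
Qed.

Lemma inverse_limit_connected (d : Order.disp_t) (D : orderType d)
    (X : D -> topologicalType) (f : forall a b : D, X b -> set (X a)) :
  inverse_limit_system f ->
  (forall (n : nat) (beta : 'I_n -> D),
    (forall i j : 'I_n, (beta i <= beta j)%O = (i <= j)%N) ->
    connected (G f beta)) ->
  connected (inverse_limit f).
Proof.
move=> f_system G_connected; apply/connectedP => E [E0 fE sE].
have [|U [V [oU oV UV0 EU EV]]] := separated_closed_open_separation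
    (prod_system_hausdorff f_system) (prod_system_compact f_system) _ sE.
  by rewrite -fE; exact: inverse_limit_closed.
have [|s sUV] := partial_limit_sub_open f_system (openU oU oV).
  by rewrite fE; exact: setUSS.
have [x Ex] := E0 false; have [y Ey] := E0 true.
have fx : inverse_limit f x by rewrite fE; left.
have fy : inverse_limit f y by rewrite fE; right.
have [sx sxU] := prod_nbhs_finite (open_nbhs_nbhs (conj oU (EU _ Ex))).
have [sy syV] := prod_nbhs_finite (open_nbhs_nbhs (conj oV (EV _ Ey))).
(* Indices from [s] force padded points into the union of [U] and [V]; those from [sx] and [sy]
   decide which of the two contains the padded restrictions of [x] and [y]. *)
have [n [beta [beta_le beta_inj beta_s]]] := sorted_enumeration (s ++ sx ++ sy).
pose K := pad beta x @` G f beta.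
have cK : connected K.
  apply: connected_continuous_connected; first exact: G_connected.
  exact/continuous_subspaceT/pad_continuous.
have KUV : K `<=` U `|` V.
  move=> _ [z Gz <-]; have Lz := partial_limit_pad x beta_le beta_inj Gz.
  apply: sUV; apply: (partial_limitS (t := codom beta)) Lz => a sa.
  have [|i <-] := beta_s a; first by rewrite mem_cat sa.
  exact: codom_f.
pose r (z : prod_topology X) : prod_topology (fun i => X (beta i)) :=
  fun i => z (beta i).
have rG z : inverse_limit f z -> G f beta (r z).
  by move=> fz i j ij; apply: fz; rewrite beta_le.
have Ux : U (pad beta x (r x)).
  apply: sxU => a sa; have [|i <-] := beta_s a; last by rewrite padE.
  by rewrite !mem_cat sa orbT.
(* The padding comes from [x], but the point agrees with [y] on [sy], which is all that membership
   in [V] requires. *)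
have Vy : V (pad beta x (r y)).
  apply: syV => a sa; have [|i <-] := beta_s a; last by rewrite padE.
  by rewrite !mem_cat sa !orbT.
have noUV z : U z -> V z -> False.
  by move=> Uz Vz; have : (U `&` V) z by []; rewrite UV0.
have [KU|KV] := connected_subset (open_disjoint_separated oU oV UV0) KUV cK.
  by apply: noUV Vy; apply: KU; exists (r y) => //; exact: rG.
by apply: noUV Ux _; apply: KV; exists (r x) => //; exact: rG.
Qed.

Unset Implicit Arguments.

Theorem theorem5p2 (d : Order.disp_t) (D : orderType d)
    (X : D -> topologicalType) (f : forall a b : D, X b -> set (X a))
    (f_system : inverse_limit_system f)
    (X_continuum : forall a : D, hausdorff_continuum [set: X a])
    (f_usc : forall a b : D, (a <= b)%O -> usc (f a b))
    (G_connected : forall (n : nat) (beta : 'I_n -> D),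
      (forall i j : 'I_n, (beta i <= beta j)%O = (i <= j)%N) ->
      connected (G f beta)) :
  hausdorff_continuum (inverse_limit f).
Proof.
split.
- exact: prod_system_hausdorff f_system.
- exact: inverse_limit_nonempty.
- apply: subclosed_compact (prod_system_compact f_system) _ => //.
  exact: inverse_limit_closed.
- exact: inverse_limit_connected.
Qed.
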